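(* Let $$L=V((u_1,\overline{v_1}),\dots,(u_m,\overline{v_m}),(r_1,s_1),\dots,(r_n,s_n),(p,q))$$ be a V-link. Let $T_1$ and $T_2$ be the parameter lists obtained by applying the standard simplifications to the two T-link presentations of $L$ $$T((r_1,s_1), \dots, (r_{n},s_{n}), (p, q-u_m), (p+ v_m, u_m - u_{m-1}), \dots, (p+v_m+\dots + v_{2}, u_2-u_1), (p+ v_m+ \dots + v_{1}, u_1))$$ and $$T((u_1, v_1), \dots, (u_{m}, v_{m}), (q, p-r_n), (q+ s_n, r_n - r_{n-1}), \dots, (q+s_n+\dots + s_{2}, r_2-r_1), (q+ s_n+ \dots + s_{1}, r_1)),$$ respectively. If $T_1$ and $T_2$ coincide as ordered lists of parameters, then one of the following holds: (1) $m=n$, $u_m<p$, $(u_i,v_i)=(r_i,s_i)$ for all $i=1,\dots,n$, and $q=p$; (2) $m=n+1$, $(u_i,v_i)=(r_i,s_i)$ for all $i=1,\dots,n$, and $(u_m,v_m)=(p,q-p)$. Conversely, in each of these two cases, the two simplified T-link presentations $T_1$ and $T_2$ coincide.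
   Context: T-links: for integers $2\le r_1<\dots<r_n$ and $s_1,\dots,s_n>0$, the T-link $T((r_1,s_1),\dots,(r_n,s_n))$ is the closure in $S^3$ of the braid $(\sigma_1\cdots\sigma_{r_1-1})^{s_1}\cdots(\sigma_1\cdots\sigma_{r_n-1})^{s_n}$ on $r_n$ strands; the ordered parameter list is called a T-link presentation. V-links: let $p,q$ be integers with $2\le p\le q$, let $2\le u_1<\dots<u_m\le p$ and $2\le r_1<\dots<r_n<p$ be possibly empty sequences of integers ($m=0$ or $n=0$ allowed), and let $v_1,\dots,v_m,s_1,\dots,s_n$ be positive integers. The V-link $V((u_1,\overline{v_1}),\dots,(u_m,\overline{v_m}),(r_1,s_1),\dots,(r_n,s_n),(p,q))$ is the closure of the braid on $p$ strands $$(\sigma_{p-1}\cdots\sigma_{p-u_1+1})^{v_1}\cdots(\sigma_{p-1}\cdots\sigma_{p-u_m+1})^{v_m}(\sigma_1\cdots\sigma_{r_1-1})^{s_1}\cdots(\sigma_1\cdots\sigma_{r_n-1})^{s_n}(\sigma_1\cdots\sigma_{p-1})^{q}.$$ Standard simplification of a parameter list: omit all pairs of the form $(r,0)$ and replace consecutive pairs $(r,a),(r,b)$ by $(r,a+b)$. Empty sequences: in the two displayed lists $u_0=0$ and $r_0=0$; thus for $m=0$ the first list is $((r_1,s_1),\dots,(r_n,s_n),(p,q))$, and for $n=0$ the second list is $((u_1,v_1),\dots,(u_m,v_m),(q,p))$. The condition $u_m<p$ is vacuous when $m=0$. *)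

(* Defs.v *)
From mathcomp Require Import all_boot.

Set Implicit Arguments.
Unset Strict Implicit.
Unset Printing Implicit Defensive.

(* A list ((r_1,s_1),...,(r_n,s_n)) of parameters of a T-link or V-link. *)
Definition params := seq (nat * nat).

(* Items are numbered from 1, and item number 0 is (0, 0); this encodes the
   conventions u_0 = 0 and r_0 = 0 for a possibly empty list. *)
Definition item (s : params) (i : nat) : nat * nat := nth (0, 0) ((0, 0) :: s) i.

(* V((u_1,\bar v_1),...,(u_m,\bar v_m),(r_1,s_1),...,(r_n,s_n),(p,q)), with
   U = ((u_1,v_1),...,(u_m,v_m)) and R = ((r_1,s_1),...,(r_n,s_n)).  The bound
   on the u_i is weak (u_m <= p), that on the r_i is strict (r_n < p). *)
Definition Vlink_params (U R : params) (p q : nat) : bool :=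
  [&& 2 <= p <= q,
      sorted ltn (unzip1 U),
      all (fun x => (2 <= x.1 <= p) && (0 < x.2)) U,
      sorted ltn (unzip1 R) &
      all (fun x => (2 <= x.1 < p) && (0 < x.2)) R].

(* For B = ((b_1,c_1),...,(b_k,c_k)), the list
   ((a + c_k, b_k - b_(k-1)), ..., (a + c_k + ... + c_2, b_2 - b_1),
    (a + c_k + ... + c_1, b_1)). *)
Definition dual_tail (B : params) (a : nat) : params :=
  [seq (a + \sum_(i <= j < (size B).+1) (item B j).2,
        (item B i).1 - (item B i.-1).1) | i <- rev (iota 1 (size B))].

(* The list A, (a, b - b_k), followed by dual_tail B a.  For a V-link given by
   U, R, p and q, the two T-link presentations are
   Tpresentation R U p q and Tpresentation U R q p.  Since u_m <= p <= q,
   r_n < p, and the u_i and the r_i increase, no subtraction is truncated. *)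
Definition Tpresentation (A B : params) (a b : nat) : params :=
  A ++ (a, b - (item B (size B)).1) :: dual_tail B a.

Fixpoint merge_equal (s : params) : params :=
  if s is x :: s' then
    if merge_equal s' is y :: t then
      if x.1 == y.1 then (x.1, x.2 + y.2) :: t else [:: x, y & t]
    else [:: x]
  else [::].

(* Pairs (r, 0) are removed first, so that pairs which become consecutive
   after the removal are merged as well. *)
Definition simplify (s : params) : params :=
  merge_equal [seq x <- s | x.2 != 0].

(* Main.v *)
(* Along the list T_1 the first coordinates strictly increase, and likewise
   along T_2, so that the standard simplifications are trivial, except when
   u_m = p = q: then (p, q - u_m) disappears from T_1, which is left without
   the first coordinate p, whereas T_2 contains (q, p - r_n).  Otherwise,
   comparing the parts of T_1 and T_2 whose first coordinates are less than p
   shows that R is the part of U below p, which is U or U without its last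
   item, and comparing the next item gives the conditions on q. *)
Require Import Defs.
From mathcomp Require Import all_boot zify.

Lemma item_size (s : params) : item s (size s) = last (0, 0) s.
Proof. by rewrite /item (nth_last (0, 0) ((0, 0) :: s)). Qed.

Lemma item_rcons (s : params) x i :
  i <= size s -> item (rcons s x) i = item s i.
Proof. by case: i => [|i] //= lis; rewrite /item /= nth_rcons lis. Qed.

Lemma eq_items (s t : params) :
    size s = size t -> (forall i, 1 <= i <= size t -> item s i = item t i) ->
  s = t.
Proof.
move=> eq_sz eq_st; apply: (@eq_from_nth _ (0, 0)) => // i lti.
by apply: (eq_st i.+1); rewrite -eq_sz.
Qed.

(** The last pair of [B] enters every partial sum, so its second coordinate can be absorbed into the
    base [a]. This allows induction on [B] from the right. *)
Lemma dual_tail_rcons B x a :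
  dual_tail (rcons B x) a =
    (a + x.2, x.1 - (last (0, 0) B).1) :: dual_tail B (a + x.2).
Proof.
have item_last : item (rcons B x) (size B).+1 = x.
  by rewrite -(size_rcons B x) item_size last_rcons.
rewrite /dual_tail size_rcons -[X in iota 1 X]addn1 iotaD rev_cat /= add1n.
rewrite big_nat1 item_last item_rcons // item_size; congr cons.
apply/eq_in_map => i; rewrite mem_rev mem_iota => /andP[i_gt0 lti].
rewrite big_nat_recr /= ?item_last; last by lia.
rewrite !item_rcons; [|lia..].
congr (_, _); rewrite addnAC addnA; congr (_ + _ + _).
by apply: eq_big_nat => j /andP[_ ltj]; rewrite item_rcons.
Qed.

Lemma path_dual_tail B a :
  all (fun x => 0 < x.2) B -> path ltn a (unzip1 (dual_tail B a)).
Proof.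
elim/last_ind: B a => [|B x IHB] a //; rewrite all_rcons dual_tail_rcons.
by case/andP=> x_gt0 B_gt0 /=; rewrite IHB // andbT; lia.
Qed.

Lemma dual_tail_neq0 B a :
  path ltn 0 (unzip1 B) -> all (fun x => x.2 != 0) (dual_tail B a).
Proof.
elim/last_ind: B a => [|B x IHB] a //.
rewrite dual_tail_rcons /unzip1 map_rcons rcons_path => /andP[pathB] /=.
by rewrite (last_map _ B (0, 0)) IHB //= andbT -lt0n subn_gt0.
Qed.

Lemma merge_equal_id s : sorted ltn (unzip1 s) -> merge_equal s = s.
Proof.
elim: s => //= x s IHs path_s; rewrite IHs ?(path_sorted path_s) //.
by case: s path_s {IHs} => //= y s /andP[/ltn_eqF ->].
Qed.

Lemma mem_unzip1_merge_equal s : unzip1 (merge_equal s) =i unzip1 s.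
Proof.
elim: s => //= x s IHs r; rewrite inE -IHs.
case: (merge_equal s) => [|y t] //=.
by case: (x.1 =P y.1) => [<-|_] /=; rewrite !inE // orbA orbb.
Qed.

Lemma simplify_id s :
  sorted ltn (unzip1 s) -> all (fun x => x.2 != 0) s -> simplify s = s.
Proof. by rewrite /simplify => s_srt /all_filterP->; exact: merge_equal_id. Qed.

(** Merging preserves the set of first coordinates, so a first coordinate disappears only with zero
    pairs. This tells [T1] and [T2] apart when [u_m = p = q]. *)
Lemma mem_unzip1_simplify s r :
  (r \in unzip1 (simplify s)) = has (fun x => (x.1 == r) && (x.2 != 0)) s.
Proof.
rewrite mem_unzip1_merge_equal; elim: s => //= x s IHs.
by case: (x.2 != 0); rewrite /= ?inE IHs ?andbT ?andbF // eq_sym.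
Qed.

Lemma simplify_Tpresentation A B a b :
    path ltn 0 (unzip1 A) -> all (fun x => 0 < x.2) A ->
    (last (0, 0) A).1 < a ->
    path ltn 0 (unzip1 B) -> all (fun x => 0 < x.2) B ->
    (last (0, 0) B).1 < b ->
  simplify (Tpresentation A B a b) = Tpresentation A B a b.
Proof.
move=> pathA A_gt0 ltAa pathB B_gt0 ltBb; apply: simplify_id; last first.
  rewrite all_cat /= item_size dual_tail_neq0 // -lt0n subn_gt0 ltBb !andbT.
  by apply: sub_all A_gt0 => x; rewrite lt0n.
suff /path_sorted : path ltn 0 (unzip1 A ++ a :: unzip1 (dual_tail B a)).
  by rewrite /Tpresentation /unzip1 map_cat.
by rewrite cat_path pathA /= (last_map _ A (0, 0)) ltAa path_dual_tail.
Qed.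

(** Both [x] and [y] are the first entry at which [P] fails, so they occupy the same position. *)
Lemma cat_cons_inj {T} {P : pred T} {s1 s2 t1 t2 : seq T} {x y} :
    all P s1 -> ~~ P x -> all P t1 -> ~~ P y ->
  s1 ++ x :: s2 = t1 ++ y :: t2 -> [/\ s1 = t1, x = y & s2 = t2].
Proof.
move=> + nPx + nPy; elim: s1 t1 => [|z s1 IHs] [|w t1] //=.
- by move=> _ _ [-> ->].
- by move=> _ /andP[Pw _] [exw]; rewrite exw Pw in nPx.
- by move=> /andP[Pz _] _ [ezy]; rewrite -ezy Pz in nPy.
- by move=> /andP[_ /IHs{}IHs] /andP[_ /IHs{}IHs] [-> /IHs[-> -> ->]].
Qed.

Lemma unzip1_rcons_lt (s : params) x :
  sorted ltn (unzip1 (rcons s x)) -> all (fun y => y.1 < x.1) s.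
Proof.
rewrite /unzip1 map_rcons (sorted_pairwise ltn_trans) pairwise_rcons.
by rewrite all_map => /andP[].
Qed.

Theorem proposition5p3 (U R : params) (p q : nat) (HL : Vlink_params U R p q) :
  let m := size U in
  let n := size R in
  let T1 := simplify (Tpresentation R U p q) in
  let T2 := simplify (Tpresentation U R q p) in
  T1 = T2 <->
    [/\ m = n,
        (item U m).1 < p,
        (forall i : nat, 1 <= i <= n -> item U i = item R i)
      & q = p]
    \/
    [/\ m = n.+1,
        (forall i : nat, 1 <= i <= n -> item U i = item R i)
      & item U m = (p, q - p)].
Proof.
move=> m n T1 T2.
case/and5P: HL => /andP[p_ge2 le_pq] srtU allU srtR allR.
have U_gt0 : all (fun x => 0 < x.2) U by apply: sub_all allU => x /andP[].
have R_gt0 : all (fun x => 0 < x.2) R by apply: sub_all allR => x /andP[].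
have R_ltp : all (fun x => x.1 < p) R.
  by apply: sub_all allR => x /andP[/andP[]].
have pathU : path ltn 0 (unzip1 U).
  rewrite path_min_sorted // all_map; apply: sub_all allU => x /=; lia.
have pathR : path ltn 0 (unzip1 R).
  rewrite path_min_sorted // all_map; apply: sub_all allR => x /=; lia.
have lastU_le : (last (0, 0) U).1 <= p.
  by case/lastP: U allU {m T1 T2 srtU U_gt0 pathU} => [|U x];
     rewrite ?last_rcons ?all_rcons //=; lia.
have lastR_lt : (last (0, 0) R).1 < p.
  by case/lastP: R R_ltp {n T1 T2 srtR allR R_gt0 pathR} => [|R x];
     rewrite ?last_rcons ?all_rcons /=; lia.
split=> [eqT|].
  (* Excludes [u_m = p = q]: there [T2] keeps the first coordinate [q], since [p - r_n > 0]. *)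
  have lastU_ltq : (last (0, 0) U).1 < q.
    rewrite ltnNge; apply/negP => le_qU.
    have eq_qp : q = p by lia.
    have : q \in unzip1 T2.
      by rewrite mem_unzip1_simplify has_cat /= item_size eqxx -lt0n subn_gt0
                 lastR_lt orbT.
    rewrite -eqT mem_unzip1_simplify => /hasP[x]; rewrite mem_cat inE item_size.
    (* In [T1], the items of [R] lie below [p], the pair [(p, q - u_m)] is zero, and the dual tail
       lies above [p]. *)
    case/or3P => [/(allP R_ltp)|/eqP->|Ux] /=; [lia..|].
    have /(order_path_min ltn_trans)/allP := path_dual_tail _ p U_gt0.
    by move/(_ x.1 (map_f _ Ux)); rewrite eq_qp /=; lia.
  move: eqT; rewrite /T1 /T2 !simplify_Tpresentation //.
  rewrite /Tpresentation !item_size {}/m => eqT.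
  have [lastU_lt|lastU_ge] := ltnP (last (0, 0) U).1 p.
    have U_ltp : all (fun x => x.1 < p) U.
      case/lastP: U srtU lastU_lt {T1 T2 allU U_gt0 pathU lastU_le lastU_ltq eqT}
        => // U x /unzip1_rcons_lt U_ltx.
      rewrite last_rcons all_rcons => ltxp; rewrite ltxp /=.
      by apply: sub_all U_ltx => y /ltn_trans; apply.
    (* The first entries not below [p] are [(p, q - u_m)] and [(q, p - r_n)]. *)
    have [||eqRU [-> _] _] := cat_cons_inj R_ltp _ U_ltp _ eqT.
    + by rewrite /= ltnn.
    + by rewrite /= -leqNgt.
    by left; rewrite /n eqRU; split.
  case/lastP: U srtU lastU_le lastU_ge eqT {T1 T2 allU U_gt0 pathU lastU_ltq}.
    (* For empty [U] the default gives [u_0 = 0 < p]. *)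
    by move=> _ _ /=; lia.
  move=> U x /unzip1_rcons_lt U_ltx.
  rewrite last_rcons cat_rcons => le_xp le_px eqT.
  have eq_xp : x.1 = p by lia.
  (* As [u_m = p], the first entry of [T2] not below [p] is now [x], the last item of [U], and it
     must equal [(p, q - p)]. *)
  have [|||eqRU eqx _] := cat_cons_inj R_ltp _ _ _ eqT.
  + by rewrite /= ltnn.
  + by rewrite -eq_xp.
  + by rewrite eq_xp ltnn.
  right; rewrite size_rcons /n eqRU -eqx eq_xp.
  by split=> // i /andP[_ lei]; rewrite item_rcons.
case=> [[eq_mn _ eqUR eq_qp]|[eq_mn eqUR eqUm]]; rewrite /T1 /T2.
  by rewrite (eq_items _ _ eq_mn eqUR) eq_qp.
have [U' eqU] : exists U', U = rcons U' (p, q - p).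
  rewrite item_size in eqUm.
  by case/lastP: U @m eq_mn eqUm {T1 T2 eqUR srtU allU U_gt0 pathU lastU_le} =>
     // U x _ _; rewrite last_rcons => <-; exists U.
have eqU' : U' = R.
  apply: eq_items => [|i lei].
    by move: eq_mn; rewrite /m eqU size_rcons => -[].
  rewrite -eqUR // eqU item_rcons //.
  by move: eq_mn lei; rewrite /m eqU size_rcons => -[->] /andP[].
(* The presentations agree even before simplification: the pair [(p, q - p)] shifts the base of the
   dual tail from [p] to [p + (q - p) = q]. *)
rewrite /Tpresentation !item_size eqU eqU' last_rcons dual_tail_rcons cat_rcons.
by rewrite /= subnKC.
Qed.
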